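(* Let $p_1,p_2$ be distinct primes and $K=\mathbb{Q}(\sqrt{p_1},\sqrt{p_2})$. Let $K_1=\mathbb{Q}(\sqrt{p_1})$, $K_2=\mathbb{Q}(\sqrt{p_2})$, $K_3=\mathbb{Q}(\sqrt{p_1p_2})$, let $\epsilon_i$ be a fundamental unit of $K_i$ and $e_i=\mathrm{Nm}_{K_i/\mathbb{Q}}(\epsilon_i)$ for $i=1,2,3$. If $p_1\equiv 1\pmod 4$, $p_2\not\equiv 3\pmod 4$, and $e_1=e_2=e_3=-1$, then the log-unit lattice of $K$ is not orthogonal.
   Context: For a totally real number field $F$ of degree $n$ with real embeddings $\phi_1,\dots,\phi_n$, define $\mathrm{Log}:F^\times\to\mathbb{R}^n$ by $\mathrm{Log}(x)=(\log|\phi_1(x)|,\dots,\log|\phi_n(x)|)$. The log-unit lattice of $F$ is $\Lambda_F=\mathrm{Log}(\mathcal{O}_F^\times)$. A fundamental unit of a real quadratic field $F$ is a unit $\epsilon$ with $\mathrm{Log}(\epsilon)$ a basis of $\Lambda_F$. A lattice in $\mathbb{R}^n$ is called orthogonal if it has a basis of pairwise orthogonal vectors with respect to the standard Euclidean inner product. *)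

(* Defs.v *)
From HB Require Import structures.
From mathcomp Require Import all_boot all_order all_algebra all_field.
From mathcomp Require Import boolp classical_sets reals exp.
Set Implicit Arguments.
Unset Strict Implicit.
Unset Printing Implicit Defensive.
Import GRing.Theory Num.Theory.
Local Open Scope ring_scope.
Local Open Scope classical_set_scope.

Section Lattices.
Variables (R : realType) (n : nat).

Definition dotp (u v : 'rV[R]_n) : R := \sum_j u 0 j * v 0 j.

(* The rows of B are the basis vectors; a lattice in R^n need not have full
   rank. *)
Definition lattice_basis (k : nat) (B : 'M[R]_(k, n)) (L : set 'rV[R]_n) :
    Prop :=
  row_free B /\ L = [set map_mx intr z *m B | z in [set: 'rV[int]_k]].

Definition orthogonal_lattice (L : set 'rV[R]_n) : Prop :=
  exists (k : nat) (B : 'M[R]_(k, n)), lattice_basis B L /\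
    (forall i j : 'I_k, i != j -> dotp (row i B) (row j B) = 0).

End Lattices.

Definition integer_ring (F : fieldExtType rat) : set F :=
  [set x | integralOver (intr : int -> F) x].

Definition integer_units (F : fieldExtType rat) : set F :=
  [set x | integer_ring x /\ exists2 y, integer_ring y & x * y = 1].

(* A numbering of the embeddings of F into R, F being totally real: a number
   field of degree n has at most n embeddings into R, so that n pairwise
   distinct ones are all of them. *)
Record real_embeddings (R : realType) (F : fieldExtType rat) :=
  RealEmbeddings {
    embedding :> 'I_(\dim {:F}) -> {rmorphism F -> R};
    embedding_inj : forall i j, embedding i =1 embedding j -> i = j }.

Section LogUnitLattice.
Variables (R : realType) (F : fieldExtType rat) (phi : real_embeddings R F).

(* Only meaningful at x != 0; by convention ln 0 = 0. *)
Definition Log (x : F) : 'rV[R]_(\dim {:F}) := \row_i ln `|phi i x|.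

Definition log_unit_lattice : set 'rV[R]_(\dim {:F}) :=
  [set Log x | x in @integer_units F].

Definition fundamental_unit (eps : F) : Prop :=
  integer_units eps /\ lattice_basis (Log eps) log_unit_lattice.

End LogUnitLattice.

(* Main.v *)
(* For a unit eta of K, eta^2 is up to sign a product of powers of e1, e2, e3
   (relative norms to K1, K2, K3), and total positivity of eta^2 forces the
   three exponents to have the same parity.  Conversely e1 e2 e3 is up to sign a
   square in K: by an explicit form of Hilbert 90 it is n times a square, with
   n a squarefree integer up to sign, and n divides p1 p2 because
   theta = sqrt (n e1 e2 e3) divides its conjugates, so that n divides the trace
   of theta x for every integral x, while the biquadratic order has discriminant
   supported at p1 p2.  As Log e1, Log e2, Log e3 are orthogonal, the log-unit
   lattice is a body-centred box lattice; its half-diagonals would have to be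
   multiples of distinct vectors of an orthogonal basis, but they are not
   pairwise orthogonal. *)
Require Import Defs.
From HB Require Import structures.
From mathcomp Require Import all_boot all_order all_algebra all_field.
From mathcomp Require Import boolp classical_sets reals exp.
From mathcomp Require Import zify ring lra.
Set Implicit Arguments.
Unset Strict Implicit.
Unset Printing Implicit Defensive.
Import Order.TTheory GRing.Theory Num.Theory.
Local Open Scope ring_scope.

(** * Body-centred lattices *)

Section BodyCentred.
Variables (R : realType) (n : nat).
Implicit Types u v w : 'rV[R]_n.

Lemma dotpC u v : dotp u v = dotp v u.
Proof. by apply: eq_bigr => j _; rewrite mulrC. Qed.

Lemma dotpDl u v w : dotp (u + v) w = dotp u w + dotp v w.
Proof. by rewrite /dotp -big_split; apply: eq_bigr => j _;
  rewrite mxE mulrDl. Qed.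

Lemma dotpZl a u v : dotp (a *: u) v = a * dotp u v.
Proof. by rewrite /dotp mulr_sumr; apply: eq_bigr => j _;
  rewrite mxE mulrA. Qed.

Lemma dotpDr u v w : dotp u (v + w) = dotp u v + dotp u w.
Proof. by rewrite dotpC dotpDl !(dotpC u). Qed.

Lemma dotpZr a u v : dotp u (a *: v) = a * dotp u v.
Proof. by rewrite dotpC dotpZl dotpC. Qed.

Lemma dotp_sumr (I : finType) u (f : I -> 'rV[R]_n) :
  dotp u (\sum_i f i) = \sum_i dotp u (f i).
Proof.
rewrite /dotp exchange_big; apply: eq_bigr => j _ /=.
by rewrite summxE mulr_sumr.
Qed.

Lemma dotp_gt0 u : u != 0 -> 0 < dotp u u.
Proof.
move=> u0; rewrite lt_neqAle eq_sym sumr_ge0 ?andbT => [|j _]; last first.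
  by rewrite -expr2 sqr_ge0.
apply: contraNneq u0 => /psumr_eq0P uE; apply/eqP/rowP => j; rewrite mxE.
apply/eqP; rewrite -[_ == 0]orbb -mulf_eq0 uE // => i _.
by rewrite -expr2 sqr_ge0.
Qed.

(** The last hypothesis says that [x] is not a sum of two non-zero orthogonal vectors [l] and
    [x - l] with [l] in [L]. The component of [x] along a row of [B] is such an [l], so a non-zero
    one is all of [x]. *)
Lemma orthogonal_lattice_generator (L : set 'rV[R]_n) k (B : 'M[R]_(k, n)) x :
  lattice_basis B L -> (forall i j, i != j -> dotp (row i B) (row j B) = 0) ->
  L x -> x != 0 ->
  (forall l, L l -> dotp l x = dotp l l -> l = 0 \/ l = x) ->
  exists i, exists c, x = c *: row i B.
Proof.
move=> [_ ->] orthB [z _ zBx] x0 minx.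
have xE : x = \sum_i (z 0 i)%:~R *: row i B.
  rewrite -zBx mulmx_sum_row; apply: eq_bigr => i _.
  by rewrite !mxE.
have [/forallP /= b0|] := boolP [forall i, (z 0 i)%:~R *: row i B == 0].
  by move: x0; rewrite xE big1 ?eqxx // => i _; apply/eqP.
rewrite negb_forall => /existsP[i xi0].
exists i, (z 0 i)%:~R; have [] := minx ((z 0 i)%:~R *: row i B).
- exists (\row_j if j == i then z 0 j else 0) => //.
  rewrite mulmx_sum_row (bigD1 i) //= big1 ?addr0 ?mxE ?eqxx // => j /negPf ji.
  by rewrite !mxE ji scale0r.
- rewrite {1}xE dotp_sumr (bigD1 i) //= big1 ?addr0 // => j ji.
  by rewrite dotpZl dotpZr orthB ?mulr0 // eq_sym.
- by move=> e; rewrite e eqxx in xi0.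
- by [].
Qed.

(* The vectors e1 w1 + e2 w2 + e3 w3 with all e_i = 1 or -1 are, up to sign, the
   unique shortest ones in their classes modulo 2L; in an orthogonal lattice
   such a vector is a multiple of a basis vector. *)
Lemma body_centred_not_orthogonal (L : set 'rV[R]_n) w1 w2 w3 :
  w1 != 0 -> w2 != 0 -> w3 != 0 ->
  dotp w1 w2 = 0 -> dotp w1 w3 = 0 -> dotp w2 w3 = 0 ->
  L (w1 + w2 + w3) -> L (- w1 + w2 + w3) -> L (w1 - w2 + w3) ->
  (forall l, L l -> exists a b c : int,
     [/\ l = a%:~R *: w1 + b%:~R *: w2 + c%:~R *: w3,
       (2 %| a + c)%Z & (2 %| b + c)%Z]) ->
  ~ orthogonal_lattice L.
Proof.
move=> /dotp_gt0 A0 /dotp_gt0 B0 /dotp_gt0 C0 o12 o13 o23 Lx Ly Lz coordL.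
move=> [k [B [basB orthB]]].
pose x (e f : int) : 'rV[R]_n := e%:~R *: w1 + f%:~R *: w2 + w3.
have dotE (a b c a' b' c' : R) :
  dotp (a *: w1 + b *: w2 + c *: w3) (a' *: w1 + b' *: w2 + c' *: w3) =
  a * a' * dotp w1 w1 + b * b' * dotp w2 w2 + c * c' * dotp w3 w3.
  rewrite !(dotpDl, dotpDr, dotpZl, dotpZr) (dotpC w2 w1) (dotpC w3 w1).
  by rewrite (dotpC w3 w2) o12 o13 o23; ring.
have xE e f : x e f = e%:~R *: w1 + f%:~R *: w2 + 1 *: w3 by rewrite scale1r.
have genx e f : `|e|%N = 1%N -> `|f|%N = 1%N -> L (x e f) ->
    exists i, exists c, x e f = c *: row i B.
  move=> e1 f1 Lxef; apply: (orthogonal_lattice_generator basB) => //.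
    apply: contraTneq C0 => xef0; have := dotE e%:~R f%:~R 1 0 0 1.
    rewrite -xE xef0 -(scale0r 0) dotpZl !mulr0 !mul0r !add0r !mul1r.
    by move=> <-; rewrite ltxx.
  move=> l /coordL[a [b [c [-> ac bc]]]]; rewrite xE !dotE => h.
  (* By [h], the terms [p * (p - q) * D] of the three axes add up to 0, where [p] and [q] are the
     coordinates of [l] and [x e f] and [D] is the squared length of the axis vector. As [p] is an
     integer and [q] is a sign, no term is negative, so each vanishes. *)
  have ge0 (p q : int) : `|q|%N = 1%N -> 0 <= p * (p - q) by nia.
  have term (p q : int) D : `|q|%N = 1%N -> 0 < D ->
      0 <= (p * (p - q))%:~R * D :> R.
    by move=> q1 D0; apply: mulr_ge0; [rewrite ler0z; apply: ge0 | apply: ltW].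
  have term0 (p q : int) D : 0 < D -> (p * (p - q))%:~R * D = 0 :> R ->
      p = 0 \/ p = q.
    move=> D0 /eqP; rewrite mulf_eq0 (gt_eqF D0) orbF intr_eq0 mulf_eq0
      subr_eq0.
    by case/orP => /eqP; [left|right].
  have ta := term a e _ e1 A0; have tb := term b f _ f1 B0.
  have tc := term c 1 _ erefl C0.
  have tE (p q : int) D : (p * (p - q))%:~R * D =
      p%:~R * p%:~R * D - p%:~R * q%:~R * D :> R.
    by rewrite intrM intrB mulrBr mulrBl.
  have := tE c 1 (dotp w3 w3).
  have := tE b f (dotp w2 w2); have := tE a e (dotp w1 w1) => tA tB tC.
  have ea := term0 a e _ A0 ltac:(lra); have eb := term0 b f _ B0 ltac:(lra).
  have ec := term0 c 1 _ C0 ltac:(lra).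
  (* Each coordinate is 0 or a sign; as [a], [b], [c] have the same parity, zeros and signs cannot
     mix. *)
  have : (a = 0 /\ b = 0 /\ c = 0) \/ (a = e /\ b = f /\ c = 1) by lia.
  case=> [[-> [-> ->]]|[-> [-> ->]]]; [left|by right].
  by rewrite !scale0r !addr0.
have orthx e f e' f' : `|e|%N = 1%N -> `|f|%N = 1%N -> `|e'|%N = 1%N ->
    `|f'|%N = 1%N -> (e, f) != (e', f') -> L (x e f) -> L (x e' f') ->
    dotp (x e f) (x e' f') = 0.
  move=> e1 f1 e1' f1' ne Lx1 Lx2.
  have [i [c cE]] := genx _ _ e1 f1 Lx1; have [j [d dE]] :=
    genx _ _ e1' f1' Lx2.
  (* On a common row the two vectors are proportional; both have [w3]-coordinate 1, so the factors
     agree and the vectors coincide, against [ne]. *)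
  have [ij|ij] := eqVneq i j; last by rewrite cE dE dotpZl dotpZr orthB ?mulr0.
  have := congr1 (fun v => d *: v) cE; rewrite ij /= scalerA mulrC -scalerA -dE.
  rewrite !xE => pE.
  have dotx (a b : R) w : dotp (a *: w1 + b *: w2 + 1 *: w3) w =
      a * dotp w1 w + b * dotp w2 w + dotp w3 w.
    by rewrite !(dotpDl, dotpZl) mul1r.
  have := congr1 (fun u => dotp u w3) pE; rewrite /= !dotpZl !dotx o13 o23
    !mulr0 !add0r.
  move=> /(mulIf (lt0r_neq0 C0)) dc; rewrite -dc in pE.
  have d0 : d != 0.
    apply: contraTneq C0 => d0; have := congr1 (fun u => dotp u w3) dE => /=.
    rewrite d0 scale0r xE dotx o13 o23 -(scale0r w3) dotpZl mul0r.
    by rewrite !mulr0 !add0r => ->; rewrite ltxx.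
  move/(scalerI d0): pE => pE.
  have := congr1 (fun u => dotp u w1) pE; rewrite /= !dotx (dotpC w2) (dotpC
    w3) o12 o13.
  rewrite !mulr0 !addr0 => /(mulIf (lt0r_neq0 A0))/intr_inj ee.
  have := congr1 (fun u => dotp u w2) pE; rewrite /= !dotx (dotpC w3) o12 o23.
  rewrite !mulr0 !addr0 !add0r => /(mulIf (lt0r_neq0 B0))/intr_inj ff.
  by move: ne; rewrite ee ff eqxx.
have L11 : L (x 1 1) by rewrite /x !scale1r.
have Lm1 : L (x (-1) 1) by rewrite /x scaleN1r scale1r.
have L1m : L (x 1 (-1)) by rewrite /x scaleN1r scale1r.
(* The two vanishing products add up to [2 * dotp w3 w3], which is positive. *)
have := orthx 1 1 (-1) 1 erefl erefl erefl erefl isT L11 Lm1.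
have := orthx 1 1 1 (-1) erefl erefl erefl erefl isT L11 L1m.
by rewrite !xE !dotE !rmorphN !rmorph1; lra.
Qed.
End BodyCentred.

(** * Algebraic integers and traces *)

Lemma square_free_part (N : nat) : (0 < N)%N ->
  exists n k, [/\ N = (n * k ^ 2)%N, (0 < k)%N
    & forall d, (d ^ 2 %| n)%N -> d = 1%N].
Proof.
have [m] := ubnP N; elim: m N => // m IHm N Nm N0.
have [sfN|nsfN] := pselect (forall d, (d ^ 2 %| N)%N -> d = 1%N).
  by exists N, 1%N; split; rewrite ?muln1.
have [d dN d1] : exists2 d, (d ^ 2 %| N)%N & d <> 1%N.
  apply: contrapT => h; apply: nsfN => d dN; apply: contrapT => d1.
  by apply: h; exists d.
have d0 : (0 < d)%N by case: d dN d1 => //; rewrite dvd0n; lia.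
have d2 : (1 < d ^ 2)%N by nia.
have [||n [k [NE k0 sfn]]] := IHm (N %/ d ^ 2)%N.
- by apply: leq_trans (ltn_Pdiv d2 N0) _.
- by rewrite divn_gt0 ?(dvdn_leq N0 dN) ?expn_gt0 ?d0.
exists n, (k * d)%N; split => //; last by rewrite muln_gt0 k0.
by rewrite expnMn mulnA -NE divnK.
Qed.

(** Let [g = gcdn n a] and [n = n' * g]. Cancelling [g] and using coprimality, [n'] divides [g], so
    [n' ^ 2] divides [n] and [n' = 1]. *)
Lemma square_free_dvd (n a : nat) : (forall d, d ^ 2 %| n -> d = 1)%N ->
  (n %| a ^ 2 -> n %| a)%N.
Proof.
move=> sfn; have [->|a0] := posnP a; first by rewrite dvdn0.
have g0 : (0 < gcdn n a)%N by rewrite gcdn_gt0 a0 orbT.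
move: (dvdn_gcdl n a) (dvdn_gcdr n a) => /dvdnP[n' nE] /dvdnP[a' aE].
have cop : coprime n' a'.
  by rewrite /coprime -(eqn_pmul2r g0) muln_gcdl -nE -aE mul1n.
move: (dvdn_gcdr n a) g0 nE aE; move: (gcdn n a) => g ga g0 nE aE.
have -> : (a ^ 2 = a' ^ 2 * g * g)%N by rewrite aE; ring.
rewrite {1}nE dvdn_pmul2r // Gauss_dvdr ?coprimeXr // => n'g.
suff n'1 : n' = 1%N by rewrite nE n'1 mul1n.
by apply: sfn; rewrite nE expnS expn1 dvdn_mul.
Qed.

Local Notation integral := (integralOver (intr : int -> _)).

(** The monic polynomial is transported to [algC], where a rational algebraic integer is known to be
    an integer. *)
Lemma integral_rat (F : fieldExtType rat) (q : rat) :
  integral (q%:A : F) -> exists z : int, q = z%:~R.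
Proof.
case=> p mon_p.
have -> : map_poly intr p = map_poly (in_alg F) (map_poly intr p).
  by rewrite -map_poly_comp; apply: eq_map_poly => z /=; rewrite scaler_int.
rewrite fmorph_root -(fmorph_root (ratr : rat -> algC)) -map_poly_comp => pq.
suff /intrP[z] : (ratr q : algC) \in Num.int.
  by rewrite -ratr_int => /fmorph_inj; exists z.
apply: Cint_rat_Aint; first by apply/CratP; exists q.
apply: root_monic_Aint pq _ _; first by rewrite map_poly_comp !monic_map.
by apply/polyOverP => i; rewrite coef_map /= ratr_int.
Qed.

Lemma integral_sqr (F : fieldType) (x : F) :
  integral (x ^+ 2) -> integral x.
Proof.
move=> Ix; apply: (@integral_root_monic _ _ _ _ ('X^2 - (x ^+ 2)%:P)).
- by rewrite monicXnsubC.
- by rewrite rootE !hornerE subrr.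
apply/integral_poly => i; rewrite coefB coefXn coefC; apply: integral_sub.
  exact: integral_nat.
by case: ifP => // _; apply: integral0.
Qed.

Lemma integral_morph (F G : fieldType) (s : {rmorphism F -> G}) x :
  integral x -> integral (s x).
Proof.
case=> p mon_p px; exists p => //; move: px; rewrite -(fmorph_root s).
rewrite -map_poly_comp; congr (is_true (root _ _)).
by apply: eq_map_poly => z /=; rewrite rmorph_int.
Qed.

Lemma integral_fmorph (F G : fieldType) (s : {rmorphism F -> G}) x :
  integral (s x) -> integral x.
Proof.
case=> p mon_p px; exists p => //; move: px; rewrite -(fmorph_root s).
rewrite -map_poly_comp; congr (is_true (root _ _)).
by apply: eq_map_poly => z /=; rewrite rmorph_int.
Qed.

Section TraceDivisibility.
Variables (K : fieldExtType rat) (s1 s2 : {rmorphism K -> K}).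
Hypothesis s1K : involutive s1.
Hypothesis s2K : involutive s2.
Hypothesis s12C : forall x, s1 (s2 x) = s2 (s1 x).
Hypothesis fixed_rat :
  forall x, s1 x = x -> s2 x = x -> exists q : rat, x = q%:A.

Variables (n : nat) (theta u : K).
Hypothesis n_gt0 : (0 < n)%N.
Hypothesis n_sqfree : forall d, (d ^ 2 %| n)%N -> d = 1%N.
Hypotheses (u_neq0 : u != 0) (int_u : integral u) (int_uV : integral u^-1).
Hypothesis theta2 : theta ^+ 2 = n%:R * u.

Let tr x := x + s1 x + s2 x + s1 (s2 x).

Let n_neq0 : n%:R != 0 :> K.
Proof.
by rewrite -(rmorph_nat (in_alg K)) fmorph_eq0 pnatr_eq0 -lt0n.
Qed.

Let theta_neq0 : theta != 0.
Proof. by rewrite -sqrf_eq0 theta2 mulf_neq0. Qed.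

(** Its square is [s u / u], because [s] fixes [n], and [u] is a unit. *)
Lemma integral_conj_quotient (s : {rmorphism K -> K}) :
  integral (s theta / theta).
Proof.
apply: integral_sqr; rewrite exprMn exprVn -rmorphXn theta2 rmorphM rmorph_nat.
rewrite invfM mulrACA divff // mul1r.
by apply: integral_mul => //; apply: integral_morph.
Qed.

(* Since theta^2 / n is a unit, theta divides each of its conjugates, hence also
   the integer t = tr (theta x); so n divides t^2. *)
Lemma trace_dvd x : integral x ->
  exists z : int, tr (theta * x) = n%:R * z%:~R.
Proof.
move=> int_x; set t := tr _.
have int_theta : integral theta.
  apply: integral_sqr; rewrite theta2; apply: integral_mul => //.
  exact: integral_nat.
have int_t : integral t.
  have int_tx : integral (theta * x) by apply: integral_mul.
  by rewrite /t /tr; repeat first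
    [exact: int_tx | apply: integral_add | apply: integral_morph].
have [q tq] : exists q : rat, t = q%:A.
  apply: fixed_rat; rewrite /t /tr !rmorphD /=.
    by rewrite s1K s1K; ring.
  by rewrite -!s12C !s2K; ring.
have [z qz] : exists z : int, q = z%:~R by apply: (@integral_rat K);
  rewrite -tq.
have tz : t = z%:~R by rewrite tq qz -(rmorph_int (in_alg K)).
have int_tt : integral (t / theta).
  have -> : t / theta = x + s1 theta / theta * s1 x + s2 theta / theta * s2 x
      + (s1 \o s2) theta / theta * (s1 \o s2) x.
    by rewrite /t /tr /= !rmorphM; field.
  repeat first [exact: int_x | exact: integral_conj_quotient
    | apply: integral_add | apply: integral_mul | apply: integral_morph].
(* The factor [u] cancels the unit in [theta ^+ 2], which leaves a number that is rational as well
   as integral. *)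
have : integral ((z%:~R ^+ 2 / n%:R : rat)%:A : K).
  have -> : (z%:~R ^+ 2 / n%:R : rat)%:A = (t / theta) ^+ 2 * u.
    rewrite exprMn exprVn theta2 tz -/(in_alg K _) rmorphM rmorphXn fmorphV.
    by rewrite rmorph_int rmorph_nat; field; rewrite u_neq0 n_neq0.
  by apply: integral_mul => //; rewrite expr2; apply: integral_mul.
case/integral_rat => w /(canRL (divfK _)); rewrite pnatr_eq0 -lt0n =>
  /(_ n_gt0).
rewrite -rmorphXn -[n%:R]/(n%:Z%:~R) -rmorphM => /intr_inj zw.
have : (n %| `|z|)%N.
  by apply: square_free_dvd => //; rewrite -abszX zw abszM dvdn_mull.
move=> /dvdnP[m zm]; exists (sgz z * m%:Z).
rewrite tz [in LHS](intEsg z) -[n%:R]/(n%:Z%:~R) -intrM; congr (_%:~R).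
by rewrite zm PoszM; ring.
Qed.

(** Products of the two dual bases are dual to [1, w1, w2, w1 * w2] for the trace, up to the factor
    [D1 * D2]. Expanding [theta] gives [D1 * D2 * theta = n * y], where [y] is integral since all
    traces are divisible by [n]. Squaring makes [(D1 * D2) ^ 2 / n = y ^+ 2 / u] integral. *)
Lemma square_free_dvd_discriminant (D1 D2 : nat) (w1 w2 a1 a2 b1 b2 : K) :
  integral w1 -> integral w2 ->
  integral a1 -> integral a2 -> integral b1 -> integral b2 ->
  s2 w1 = w1 -> s1 w2 = w2 ->
  a1 + w1 * b1 = D1%:R -> a1 + s1 w1 * b1 = 0 ->
  a2 + w2 * b2 = D2%:R -> a2 + s2 w2 * b2 = 0 ->
  (n %| (D1 * D2) ^ 2)%N.
Proof.
move=> Iw1 Iw2 Ia1 Ia2 Ib1 Ib2 w1s2 w2s1 D1E D1E0 D2E D2E0.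
have [t1 t1E] := trace_dvd (integral1 _).
have [t2 t2E] := trace_dvd Iw1.
have [t3 t3E] := trace_dvd Iw2.
have [t4 t4E] := trace_dvd (integral_mul Iw1 Iw2).
pose y := t1%:~R * (a1 * a2) + t2%:~R * (b1 * a2) + t3%:~R * (a1 * b2)
  + t4%:~R * (b1 * b2) : K.
have Iz z : integral (z%:~R : K) by apply: (integral_id intr).
have Iy : integral y.
  by rewrite /y; repeat first
    [exact: Iz | assumption | apply: integral_add | apply: integral_mul].
have yE : (D1 * D2)%:R * theta = n%:R * y.
  have -> : n%:R * y = tr (theta * 1) * (a1 * a2) + tr (theta * w1) * (b1 * a2)
      + tr (theta * w2) * (a1 * b2) + tr (theta * (w1 * w2)) * (b1 * b2).
    by rewrite t1E t2E t3E t4E /y; ring.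
  rewrite natrM -D1E -D2E /tr !(rmorphM s1, rmorphM s2) !rmorph1 w1s2 w2s1.
  (* Sorted by the conjugates of [theta], every term but the first has a factor that is zero by
     [D1E0] or [D2E0]. *)
  transitivity (theta * ((a1 + w1 * b1) * (a2 + w2 * b2))
    + s1 theta * ((a1 + s1 w1 * b1) * (a2 + w2 * b2))
    + s2 theta * ((a1 + w1 * b1) * (a2 + s2 w2 * b2))
    + s1 (s2 theta) * ((a1 + s1 w1 * b1) * (a2 + s2 w2 * b2))).
    by rewrite D1E0 D2E0; ring.
  by rewrite (s12C w2) w2s1; ring.
have : integral ((((D1 * D2) ^ 2)%:R / n%:R : rat)%:A : K).
  have -> : (((D1 * D2) ^ 2)%:R / n%:R : rat)%:A = y ^+ 2 * u^-1.
    rewrite -/(in_alg K _) rmorphM fmorphV !rmorph_nat natrX.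
    have -> : y = (D1 * D2)%:R * theta / n%:R by rewrite yE mulrC mulKf.
    rewrite exprMn (exprMn _ _ theta) theta2.
    by field; rewrite u_neq0 n_neq0.
  by apply: integral_mul => //; rewrite expr2; apply: integral_mul.
case/integral_rat => w /(canRL (divfK _)); rewrite pnatr_eq0 -lt0n =>
  /(_ n_gt0).
rewrite -[n%:R]/(n%:Z%:~R) -[X in X = _]/((((D1 * D2) ^ 2)%:Z)%:~R) -rmorphM.
by move=> /intr_inj/(congr1 absz); rewrite abszM /= => ->; rewrite dvdn_mull.
Qed.

End TraceDivisibility.

(** * Quadratic and biquadratic fields *)

(* With b = z * N(1 + x y), where N is the relative norm to the subfield fixed
   by s1 s2, one has b * s1 b = m^2 with m fixed by s1 and s2; Hilbert 90 for
   b / m then reads (b + s1 b + 2 m) * b = (b + m)^2. *)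
Lemma square_class_fixed (F : fieldType) (s1 s2 : {rmorphism F -> F})
    (x y z : F) :
  x != 0 -> y != 0 -> z != 0 -> x ^+ 2 != -1 ->
  s1 x = - x^-1 -> s2 x = x -> s1 y = y -> s2 y = - y^-1 ->
  s1 z = - z^-1 -> s2 z = - z^-1 ->
  exists rho delta, [/\ s1 rho = rho, s2 rho = rho, rho != 0
    & x * y * z = rho * delta ^+ 2].
Proof.
move=> x0 y0 z0 x2 s1x s2x s1y s2y s1z s2z.
pose b := (2 + x * y + (x * y)^-1) * z.
pose b' := (y / x + x / y - 2) / z.
(* This is the trace [y + s2 y] minus the trace [x + s1 x], hence fixed by [s1] and [s2]. *)
pose m := (y - y^-1) - (x - x^-1).
have s1b : s1 b = b'.
  rewrite /b /b' !(rmorphM, rmorphD, fmorphV, rmorph1,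
    rmorph_nat) /= s1x s1y s1z.
  by field; rewrite x0 y0 z0 !oppr_eq0 oner_eq0.
have s2b : s2 b = b'.
  rewrite /b /b' !(rmorphM, rmorphD, fmorphV, rmorph1,
    rmorph_nat) /= s2x s2y s2z.
  by field; rewrite x0 y0 z0 !oppr_eq0 oner_eq0.
have s1b' : s1 b' = b.
  rewrite /b /b' !(rmorphM, rmorphD, rmorphN, fmorphV, rmorph1,
    rmorph_nat) /= s1x s1y s1z.
  by field; rewrite x0 y0 z0 !oppr_eq0 oner_eq0.
have s2b' : s2 b' = b.
  rewrite /b /b' !(rmorphM, rmorphD, rmorphN, fmorphV, rmorph1,
    rmorph_nat) /= s2x s2y s2z.
  by field; rewrite x0 y0 z0 !oppr_eq0 oner_eq0.
have s1m : s1 m = m.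
  rewrite /m !(rmorphD, rmorphN, fmorphV) /= s1x s1y.
  by field; rewrite x0 y0 !oppr_eq0 oner_eq0.
have s2m : s2 m = m.
  rewrite /m !(rmorphD, rmorphN, fmorphV) /= s2x s2y.
  by field; rewrite x0 y0 !oppr_eq0 oner_eq0.
have neq_xV (t : F) : t ^+ 2 != -1 -> t != 0 -> t != - t^-1.
  by move=> t2 t0; apply: contraNneq t2 => e;
    rewrite expr2 [X in X * _]e mulNr mulVf.
(* Both [y = x] and [x * y = -1] would force [x = - x^-1], since [s1] fixes [y]; excluding them
   makes [m] non-zero. *)
have yNx : y != x.
  by apply: contraNneq (neq_xV _ x2 x0) => e; rewrite -s1x -e s1y.
have xy1 : 1 + x * y != 0.
  apply: contraNneq (neq_xV _ x2 x0) => e.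
  have yE : y = - x^-1 by apply: (mulfI x0); rewrite mulrN divff //; apply/eqP;
    rewrite -addr_eq0 addrC e.
  by rewrite -yE -s1y yE rmorphN fmorphV s1x invrN invrK opprK.
have m0 : m != 0.
  have -> : m = (y - x) * (1 + x * y) / (x * y) by rewrite /m; field;
    rewrite x0 y0.
  by rewrite !mulf_neq0 ?invr_eq0 ?mulf_neq0 ?subr_eq0.
have bE : b = (1 + x * y) ^+ 2 / (x * y) * z by rewrite /b; field;
  rewrite x0 y0.
have b0 : b != 0 by rewrite bE !mulf_neq0 ?invr_eq0 ?mulf_neq0 ?expf_neq0.
have bb' : b * b' = m ^+ 2.
  by rewrite /b /b' /m; field; rewrite x0 y0 z0.
have xyzE : x * y * z = b * ((1 + x * y) * z / b) ^+ 2.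
  by rewrite exprMn expr2 exprVn bE; field; rewrite ?x0 ?y0 ?z0 ?xy1.
(* In this degenerate case Hilbert 90 gives nothing, but [b = - m] is itself fixed. *)
have [bm|bm] := eqVneq (b + m) 0.
  exists (- m), ((1 + x * y) * z / b); split;
    rewrite ?rmorphN ?s1m ?s2m ?oppr_eq0 //.
  by rewrite {1}xyzE -(addr0_eq bm) opprK.
pose rho := b + b' + 2 * m.
have rhoE : b * rho = (b + m) ^+ 2.
  by rewrite /rho -[RHS](addrK (m ^+ 2)) -{1}bb'; ring.
have rho0 : rho != 0.
  by apply: contraNneq (expf_neq0 2 bm) => e; rewrite -rhoE e mulr0.
exists rho, ((1 + x * y) * z / b * ((b + m) / rho)); split => //.
- by rewrite /rho !rmorphD rmorphM rmorph_nat s1b s1b' s1m; ring.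
- by rewrite /rho !rmorphD rmorphM rmorph_nat s2b s2b' s2m; ring.
rewrite xyzE [in RHS]exprMn [in X in _ = _ * (_ * X)]exprMn -rhoE.
by field; rewrite rho0 b0.
Qed.

(** A rational square root of an integer is integral, hence an integer; [rat^o] is [rat] as an
    extension of itself. *)
Lemma rat_sqrt_nat (N : nat) (q : rat) : q ^+ 2 = N%:R -> exists m,
  N = (m ^ 2)%N.
Proof.
move=> q2; have [z qz] : exists z : int, q = z%:~R.
  apply: (@integral_rat rat^o); apply: integral_sqr.
  rewrite -/(in_alg rat^o _) -rmorphXn q2 rmorph_nat; exact: integral_nat.
exists `|z|%N; move: q2; rewrite qz -rmorphXn -[N%:R]/(N%:Z%:~R) => /intr_inj.
by move/(congr1 absz); rewrite abszX /=.
Qed.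

Lemma prime_not_square p m : prime p -> p <> (m ^ 2)%N.
Proof.
by move=> pr_p /(congr1 (logn p)); rewrite lognX logn_prime // eqxx; lia.
Qed.

Lemma prime_mul_not_square p q m : prime p -> prime q -> p <> q ->
  (p * q <> m ^ 2)%N.
Proof.
move=> pr_p pr_q /eqP pq /(congr1 (logn p)).
rewrite lognX lognM ?prime_gt0 // (logn_prime p pr_p) (logn_prime p pr_q) eqxx.
by rewrite (negPf pq); lia.
Qed.

(** Each step of Horner's scheme at [r] preserves the form [a + b * r], as [r ^+ 2] lies in [U]. *)
Lemma Fadjoin_sqrtP (F : fieldType) (L : fieldExtType F) (U : {subfield L}) r x
  :
  r ^+ 2 \in U -> x \in <<U; r>>%VS ->
  exists a b, [/\ a \in U, b \in U & x = a + b * r].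
Proof.
move=> r2 /Fadjoin_polyP[p /allP Up ->].
rewrite /horner; elim: (p : seq L) Up => [|c s IHs] Us /=.
  by exists 0, 0; rewrite mul0r addr0 !mem0v.
have [y ys|a [b [Ua Ub ->]]] := IHs; first by apply: Us; rewrite inE ys orbT.
exists (b * r ^+ 2 + c), a; split => //; last by ring.
by apply: rpredD; [apply: rpredM | apply/Us/mem_head].
Qed.

(** The minimal polynomial divides ['X^2 - (r ^+ 2)%:P], and degree 1 would put [r] in [U]. *)
Lemma adjoin_degree_sqrt (F : fieldType) (L : fieldExtType F) (U : {subfield
  L}) r :
  r ^+ 2 \in U -> r \notin U -> adjoin_degree U r = 2%N.
Proof.
move=> r2 rU; have : minPoly U r %| 'X^2 - (r ^+ 2)%:P.
  apply: minPoly_dvdp; last by rewrite rootE !hornerE subrr.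
  by rewrite rpredB ?polyOverXn ?polyOverC.
move/dvdp_leq; rewrite size_XnsubC // size_minPoly -size_poly_eq0 size_XnsubC
  //.
move=> /(_ isT); rewrite -adjoin_deg_eq1 in rU => d3.
have d0 : (0 < adjoin_degree U r)%N by [].
by move: rU d0 d3; case: (adjoin_degree U r) => [|[|[|]]].
Qed.

Lemma rmorph_rat_alg (F G : fieldExtType rat) (s : {rmorphism F ->
  G}) (q : rat) :
  s q%:A = q%:A.
Proof. exact: etrans (fmorph_eq_rat (s \o in_alg F) q) (esym (fmorph_eq_rat
  (in_alg G) q)). Qed.

(** * Conjugations and norms of quadratic extensions *)

Section Conjugation.
Variable K : splittingFieldType rat.

Lemma galois_rat : galois 1 {:K}.
Proof.
rewrite /galois sub1v normalFieldf andbT /=; apply/separableP => x _.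
apply: pcharf0_separable => p.
by rewrite (pchar_lalg K) pchar_num.
Qed.

(** By Galois theory some automorphism over [E] moves [r]; it fixes [r ^+ 2], so it sends [r] to
    [- r]. *)
Lemma exists_conj (E : {subfield K}) r : r ^+ 2 \in E -> r \notin E ->
  exists s : {rmorphism K -> K}, s r = - r /\ {in E, s =1 id}.
Proof.
move=> r2 rE.
have galE : galois E {:K} by rewrite (galoisS _ galois_rat) // sub1v subvf.
have [g gE gr] : exists2 g, g \in 'Gal({:K} / E)%g & g r != r.
  apply: contrapT => h; case/negP: rE.
  rewrite -(galois_fixedField galE); apply/fixedFieldP; first exact: memvf.
  by move=> g gE; apply: contrapT => /eqP gr; apply: h; exists g.
exists (gal_repr g); split => [|x xE]; last by apply: (fixed_gal _ gE);
  rewrite ?subvf.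
have : g r ^+ 2 == r ^+ 2 by rewrite -[X in _ == X](fixed_gal _ gE r2) ?subvf
  // rmorphXn.
by rewrite eqf_sqr (negPf gr) => /eqP.
Qed.

(** The Galois group has order 2, and its non-trivial element agrees with [s] on [<<1; r>>] because
    both negate [r]. *)
Lemma galNorm_quadratic r (s : {rmorphism K -> K}) x :
  r ^+ 2 \in 1%VS -> r \notin 1%VS -> s r = - r -> x \in <<1; r>>%VS ->
  galNorm 1 <<1; r>> x = x * s x.
Proof.
move=> r2 r1 sr xE; set E := <<1; r>>%AS.
have sq (g : gal_of E) : g \in 'Gal(E / 1)%g -> g r = r \/ g r = - r.
  move=> gE; have : g r ^+ 2 == r ^+ 2 by rewrite -[X in _ == X](fixed_gal _ gE
    r2) ?sub1v // rmorphXn.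
  by rewrite eqf_sqr => /orP[/eqP|/eqP]; [left|right].
have galE : galois 1 E.
  case/and3P: galois_rat => _ sep1K _.
  rewrite /galois sub1v (separableSr (subvf _) sep1K) /=.
  (* Normality: [r ^+ 2] is rational, so every image of [r] is [r] or [- r] and generates the same
     field. *)
  apply/forall_inP => f _.
  have : f r ^+ 2 == r ^+ 2.
    have [q qE] := vlineP _ _ r2.
    by rewrite -rmorphXn /= qE linearZ /= rmorph1.
  rewrite eqf_sqr aimg_adjoin aimg1 => /orP[/eqP -> //|/eqP ->].
  rewrite eqEsubv; apply/andP; split; apply/FadjoinP; split;
    rewrite ?subv_adjoin //.
    by rewrite memvN memv_adjoin.
  by rewrite -memvN memv_adjoin.
have cardE : #|'Gal(E / 1)%g| = 2%N.
  by rewrite -(galois_dim galE) -adjoin_degreeE adjoin_degree_sqrt.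
have [g gE gr] : exists2 g, g \in 'Gal(E / 1)%g & g != 1%g.
  apply: contrapT => h; move: cardE; rewrite (_ : 'Gal(E / 1)%g = [set (1 :
    gal_of E)%g]) ?cards1 //.
  apply/finset.setP => g; rewrite !inE; apply/idP/eqP => [gE|->];
    last exact: fingroup.group1.
  by apply: contrapT => /eqP g1; apply: h; exists g.
have gr' : g r = - r.
  case: (sq g gE) => // e; case/negP: gr.
  by rewrite (gal_adjoin_eq gE (fingroup.group1 _)) gal_id e.
rewrite /galNorm (_ : 'Gal(E / 1)%g = [set (1 : gal_of E)%g; g]); last first.
  apply/esym/eqP; rewrite eqEcard cardE cards2 eq_sym gr andbT.
  by apply/fintype.subsetP => h; rewrite !inE => /orP[] /eqP -> //;
    apply: fingroup.group1.
rewrite big_setU1 ?inE 1?eq_sym //= big_set1 gal_id; congr (_ * _).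
have [a [b [/vlineP[a' ->] /vlineP[b' ->] ->]]] := Fadjoin_sqrtP r2 xE.
by rewrite !rmorphD !rmorphM !rmorph_rat_alg /= sr gr'.
Qed.
End Conjugation.

(** * The logarithmic embedding *)

Section LogLemmas.
Variables (R : realType) (F : fieldExtType rat) (phi : real_embeddings R F).
Implicit Types x y : F.

Let norm_gt0 i x : x != 0 -> 0 < `|phi i x|.
Proof. by move=> x0; rewrite normr_gt0 fmorph_eq0. Qed.

Lemma LogM x y : x != 0 -> y != 0 -> Log phi (x * y) = Log phi x + Log phi y.
Proof.
move=> x0 y0; apply/rowP => i; rewrite !mxE rmorphM normrM lnM // posrE.
  exact: norm_gt0.
exact: norm_gt0.
Qed.

Lemma LogV x : x != 0 -> Log phi x^-1 = - Log phi x.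
Proof.
by move=> x0; apply/rowP => i; rewrite !mxE fmorphV normfV lnV // posrE
  norm_gt0.
Qed.

Lemma LogN x : Log phi (- x) = Log phi x.
Proof. by apply/rowP => i; rewrite !mxE rmorphN normrN. Qed.

Lemma Log_sign (b : bool) x : Log phi ((-1) ^+ b * x) = Log phi x.
Proof. by case: b; rewrite ?mul1r // mulN1r LogN. Qed.

Lemma LogXz x (n : int) : x != 0 -> Log phi (x ^ n) = n%:~R *: Log phi x.
Proof.
move=> x0; suff LogXn m : Log phi (x ^+ m) = m%:R *: Log phi x.
  by case: n => m; [exact: LogXn | rewrite /= LogV ?expf_neq0 // LogXn NegzE
    mulrNz scaleNr].
elim: m => [|m IHm]; last first.
  by rewrite exprS LogM ?expf_neq0 // IHm mulrS scalerDl scale1r.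
by apply/rowP => i; rewrite !mxE rmorph1 normr1 ln1 mul0r.
Qed.

(** One coordinate suffices: a field embedding is injective, so equal absolute values there mean
    equality up to sign. *)
Lemma Log_eq x y : x != 0 -> y != 0 -> Log phi x = Log phi y ->
  exists b : bool, x = (-1) ^+ b * y.
Proof.
move=> x0 y0 /rowP /(_ (Ordinal (adim_gt0 {:F}%AS))); rewrite !mxE.
set i := Ordinal _ => /ln_inj; rewrite !posrE =>
  /(_ (norm_gt0 _ x0) (norm_gt0 _ y0)).
move=> /eqP; rewrite eqr_norm2 -rmorphN !fmorph_eq => /orP[]/eqP ->.
  by exists false; rewrite mul1r.
by exists true; rewrite mulN1r.
Qed.

Lemma sqr_neqN1 x : x ^+ 2 != -1.
Proof.
have i := Ordinal (adim_gt0 {:F}%AS); apply/eqP => /(congr1 (phi i)).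
rewrite rmorphXn rmorphN1 => e; have := sqr_ge0 (phi i x).
by rewrite e oppr_ge0 ler10.
Qed.

Lemma Log_neq0 x : x != 0 -> x ^+ 2 != 1 -> Log phi x != 0.
Proof.
move=> x0; apply: contraNneq => xE; have Log1 : Log phi x = Log phi 1.
  by rewrite xE -[1]/(1 ^ 0) LogXz ?oner_eq0 // scale0r.
by have [b ->] := Log_eq x0 (oner_neq0 _) Log1; rewrite mulr1 sqrr_sign.
Qed.

(** Composition with [s] permutes the embeddings, hence the coordinates of [Log]. *)
Lemma dotp_Log_conj (s : {rmorphism F -> F}) x y : involutive s ->
  (forall i, exists j, phi j =1 phi i \o s) ->
  dotp (Log phi (s x)) (Log phi (s y)) = dotp (Log phi x) (Log phi y).
Proof.
move=> sK /choice[f fE].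
have f_inj : injective f.
  move=> i j eq_f; apply: (@embedding_inj _ _ phi) => z.
  by rewrite -(sK z) -[LHS]fE -[RHS]fE eq_f.
rewrite /dotp [RHS](reindex_inj f_inj); apply: eq_bigr => i _.
by rewrite !mxE !fE.
Qed.

End LogLemmas.

Lemma integer_unitsP (F : fieldExtType rat) (x : F) :
  integer_units x <-> [/\ x != 0, integral x & integral x^-1].
Proof.
split=> [[Ix [y Iy xy1]]|[x0 Ix IxV]]; last first.
  by split=> //; exists x^-1; rewrite ?divff.
have x0 : x != 0.
  by apply: contra_eq_neq xy1 => ->; rewrite mul0r eq_sym oner_eq0.
by split=> //; have -> : x^-1 = y by apply: (mulfI x0); rewrite xy1 divff.
Qed.

(** [Log eps] spans the lattice of the subfield, and [Log] determines a unit up to sign. *)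
Lemma fundamental_unit_generates (R : realType) (K : fieldExtType rat)
    (E : {subfield K}) (phi : real_embeddings R (subvs_of E)) (eps : subvs_of
      E) x :
  fundamental_unit phi eps -> x \in E -> integer_units x ->
  exists (b : bool) (n : int), x = (-1) ^+ b * vsval eps ^ n.
Proof.
move=> [/integer_unitsP[eps0 _ _] [_ latE]] xE /integer_unitsP[x0 Ix IxV].
pose y := Subvs xE; have yE : x = vsval y by [].
have y0 : y != 0 by apply: contraNneq x0 => y0; rewrite yE y0.
have : log_unit_lattice phi (Log phi y).
  exists y => //; apply/integer_unitsP; split=> //.
    exact: (@integral_fmorph _ _ vsval).
  by apply: (@integral_fmorph _ _ vsval); rewrite fmorphV.
rewrite latE => -[z _ zE].
have : Log phi y = Log phi (eps ^ z 0 0).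
  rewrite LogXz // -zE; apply/rowP => j; rewrite !mxE big_ord1 !mxE //.
case/Log_eq => [//||b yb]; first by rewrite expfz_neq0.
by exists b, (z 0 0); rewrite yE yb rmorphM rmorph_sign fmorphXz.
Qed.

Lemma natr_fieldExt_neq0 (K : fieldExtType rat) n : n.+1%:R != 0 :> K.
Proof. by rewrite -(rmorph_nat (in_alg K)) fmorph_eq0 pnatr_eq0. Qed.

Lemma mem_adjoin1_affine (K : fieldExtType rat) (t : K) (a b : rat) :
  a%:A + b%:A * t \in <<1; t>>%VS.
Proof.
have ratE (q : rat) : q%:A \in <<1; t>>%VS.
  by apply: subvP_adjoin; apply: memvZ; apply: mem1v.
by apply: rpredD => //; apply: rpredM => //; apply: memv_adjoin.
Qed.

(** * Arithmetic of the biquadratic field *)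

Section Biquadratic.
Variables (p1 p2 : nat) (K : splittingFieldType rat) (r1 r2 : K).
Hypotheses (pr_p1 : prime p1) (pr_p2 : prime p2) (p12 : p1 <> p2).
Hypotheses (r1E : r1 ^+ 2 = p1%:R) (r2E : r2 ^+ 2 = p2%:R).
Hypothesis genK : <<<<1; r1>>; r2>>%VS = {:K}%VS.

Lemma sqrt_prime_irrational (p : nat) (t : K) : prime p -> t ^+ 2 = p%:R ->
  t \notin 1%VS.
Proof.
move=> pr_p t2; apply/negP => /vlineP[q tq]; move: t2.
rewrite tq -/(in_alg K _) -rmorphXn -(rmorph_nat (in_alg K)).
by move=> /fmorph_inj/rat_sqrt_nat[m /(prime_not_square pr_p)].
Qed.

(** Squaring [x = a + b * y] puts [2 * a * b * y] among the rationals, so [a] or [b] is 0. Then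
    [p * q] or [p] would be the square of a rational. *)
Lemma sqrt_primes_independent (p q : nat) (x y : K) :
  prime p -> prime q -> p <> q -> x ^+ 2 = p%:R -> y ^+ 2 = q%:R ->
  x \notin <<1; y>>%VS.
Proof.
move=> pr_p pr_q pq x2 y2; apply/negP => xE.
have y2_1 : y ^+ 2 \in 1%VS by rewrite y2 rpred_nat.
have [a [b [/vlineP[a' aE] /vlineP[b' bE] xab]]] := Fadjoin_sqrtP y2_1 xE.
have {aE bE}xab : x = in_alg K a' + in_alg K b' * y by rewrite xab aE bE.
have eqE : in_alg K (p%:R - a' ^+ 2 - b' ^+ 2 * q%:R) = in_alg K (2 * a' * b')
  * y.
  rewrite !(rmorphB, rmorphM, rmorphXn, rmorph_nat) -x2 -y2 xab.
  by ring.
have [ab0|ab0] := eqVneq (2 * a' * b') 0; last first.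
  case/negP: (sqrt_prime_irrational pr_q y2); apply/vlineP.
  exists ((p%:R - a' ^+ 2 - b' ^+ 2 * q%:R) / (2 * a' * b')).
  rewrite -/(in_alg K _) rmorphM fmorphV /= -![_%:A]/(in_alg K _) eqE mulrAC
    divff ?mul1r //.
  by rewrite fmorph_eq0.
move/eqP: eqE; rewrite ab0 rmorph0 mul0r fmorph_eq0 => /eqP eqE.
move/eqP: ab0; rewrite !mulf_eq0 pnatr_eq0 orFb => /orP[]/eqP z0; move: eqE.
  rewrite z0 => eqE; have /rat_sqrt_nat[m] : (b' * q%:R) ^+ 2 = (p * q)%:R.
    by rewrite natrM; move: eqE => /eqP; rewrite expr0n subr0 subr_eq0 =>
      /eqP ->; ring.
  exact: prime_mul_not_square.
rewrite z0 => eqE; have /rat_sqrt_nat[m] : a' ^+ 2 = p%:R.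
  by move: eqE => /eqP; rewrite expr0n mul0r subr0 subr_eq0 => /eqP ->.
exact: prime_not_square.
Qed.

Let r1sq : r1 ^+ 2 \in 1%VS. Proof. by rewrite r1E rpred_nat. Qed.

Lemma biquadratic_dim : \dim {:K} = 4%N.
Proof.
have p21 : p2 <> p1 by move=> e; apply: p12.
rewrite -genK dim_Fadjoin adjoin_degree_sqrt; last 2 first.
- by rewrite r2E rpred_nat.
- exact: sqrt_primes_independent r2E r1E.
rewrite dim_Fadjoin adjoin_degree_sqrt ?dimv1 //.
exact: sqrt_prime_irrational r1E.
Qed.

Lemma biquadratic_coord x : exists a b c d : rat,
  x = a%:A + b%:A * r1 + (c%:A + d%:A * r1) * r2.
Proof.
have := memvf x; rewrite -genK => xK.
have r2sq1 : r2 ^+ 2 \in <<1; r1>>%VS by rewrite r2E rpred_nat.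
have [a [b [aE bE ->]]] := Fadjoin_sqrtP r2sq1 xK.
have [a1 [a2 [/vlineP[q1 ->] /vlineP[q2 ->] ->]]] := Fadjoin_sqrtP r1sq aE.
have [b1 [b2 [/vlineP[q3 ->] /vlineP[q4 ->] ->]]] := Fadjoin_sqrtP r1sq bE.
by exists q1, q2, q3, q4.
Qed.

Lemma rmorph_biquadratic_eq (F : numFieldType) (f g : {rmorphism K -> F}) :
  f r1 = g r1 -> f r2 = g r2 -> f =1 g.
Proof.
move=> f1 f2 x; have [a [b [c [d ->]]]] := biquadratic_coord x.
have fg q : f q%:A = g q%:A.
  exact: etrans (fmorph_eq_rat (f \o in_alg K) q) (esym (fmorph_eq_rat (g \o
    in_alg K) q)).
by rewrite !(rmorphD, rmorphM) !fg f1 f2.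
Qed.

Lemma biquadratic_conj : exists s1 s2 : {rmorphism K -> K},
  [/\ s1 r1 = - r1, s1 r2 = r2, s2 r1 = r1 & s2 r2 = - r2].
Proof.
have p21 : p2 <> p1 by move=> e; apply: p12.
have r1sq2 : r1 ^+ 2 \in <<1; r2>>%VS by rewrite r1E rpred_nat.
have r2sq1 : r2 ^+ 2 \in <<1; r1>>%VS by rewrite r2E rpred_nat.
have [s1 [s1r1 s1E]] := exists_conj r1sq2 (sqrt_primes_independent pr_p1 pr_p2
  p12 r1E r2E).
have [s2 [s2r2 s2E]] := exists_conj r2sq1 (sqrt_primes_independent pr_p2 pr_p1
  p21 r2E r1E).
exists s1, s2; split=> //; first exact/s1E/memv_adjoin.
exact/s2E/memv_adjoin.
Qed.

Variables s1 s2 : {rmorphism K -> K}.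
Hypotheses (s1r1 : s1 r1 = - r1) (s1r2 : s1 r2 = r2).
Hypotheses (s2r1 : s2 r1 = r1) (s2r2 : s2 r2 = - r2).

Let coordE := (rmorphD, rmorphM, rmorph_rat_alg).

Lemma conj1K : involutive s1.
Proof.
move=> x; have [a [b [c [d ->]]]] := biquadratic_coord x.
by rewrite !coordE !s1r1 !s1r2 rmorphN s1r1 opprK.
Qed.

Lemma conj2K : involutive s2.
Proof.
move=> x; have [a [b [c [d ->]]]] := biquadratic_coord x.
by rewrite !coordE !s2r1 !s2r2 rmorphN s2r2 opprK.
Qed.

Lemma conj12C x : s1 (s2 x) = s2 (s1 x).
Proof.
have [a [b [c [d ->]]]] := biquadratic_coord x.
by rewrite !coordE !(s1r1, s1r2, s2r1, s2r2) !rmorphN !(s1r1, s1r2, s2r1, s2r2).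
Qed.

Lemma conj_fixed_rat x : s1 x = x -> s2 x = x -> exists q : rat, x = q%:A.
Proof.
have [a [b [c [d xE]]]] := biquadratic_coord x; move=> s1x s2x; exists a.
have four0 : 4 != 0 :> K := natr_fieldExt_neq0 K 3.
apply: (mulfI four0).
have -> : 4 * x = x + s1 x + s2 x + s1 (s2 x) by rewrite !(s2x, s1x); ring.
rewrite xE !coordE !(s1r1, s1r2, s2r1, s2r2) !rmorphN !(s1r1, s1r2, s2r1, s2r2).
by ring.
Qed.

(* (a / D, b / D) is the basis dual to (1, w) for the trace form; D = p and
   w = (1 + t) / 2 if p = 1 mod 4, while D = 4 and w = t if p = 2. *)
Lemma quadratic_dual_basis (p : nat) (t : K) (s : {rmorphism K -> K}) :
  prime p -> (p <> 3 %[mod 4])%N -> t ^+ 2 = p%:R -> s t = - t ->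
  exists (D : nat) (w a b : K), [/\ (D %| p ^ 2)%N,
    [/\ integral w, integral a & integral b],
    forall s' : {rmorphism K -> K}, s' t = t -> s' w = w,
    a + w * b = D%:R & a + s w * b = 0].
Proof.
move=> pr_p p3 t2 st.
have It : integral t by apply: integral_sqr; rewrite t2; apply: integral_nat.
have [p2'|p_odd] := even_prime pr_p.
  exists 4%N, t, 2, t; rewrite st p2'; split=> //.
  - by split=> //; apply: integral_nat.
  - by rewrite -expr2 t2 p2'; ring.
  - by rewrite mulNr -expr2 t2 p2' subrr.
have [k pk] : exists k, p = (4 * k + 1)%N.
  by exists (p %/ 4)%N; move: p3 p_odd; lia.
have two0 : 2 != 0 :> K := natr_fieldExt_neq0 K 1.
pose w := (1 + t) / 2.
have sw : s w = (1 - t) / 2 by rewrite /w rmorphM fmorphV rmorph_nat rmorphD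
  rmorph1 st.
have Iw : integral w.
  (* With [p = 4 * k + 1], the element [w] is a root of [X^2 - X - k]. *)
  apply: (@integral_root_monic _ _ _ _ ('X^2 - ('X + k%:R%:P))).
  - rewrite monicE lead_coefDl ?lead_coefXn //.
    by rewrite size_polyXn size_opp size_XaddC.
  - rewrite rootE !hornerE; have -> : w ^+ 2 = (1 + 2 * t + t ^+ 2) / 4.
      by rewrite /w; field; rewrite (natr_fieldExt_neq0 K 3) two0.
    rewrite t2 pk natrD natrM /w; apply/eqP; field.
    by rewrite (natr_fieldExt_neq0 K 3) two0.
  apply/integral_poly => i; rewrite !(coefB, coefD, coefXn, coefX, coefC).
  apply: integral_sub; first exact: integral_nat.
  apply: integral_add; first exact: integral_nat.
  by case: ifP => _; [apply: integral_nat | apply: integral0].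
have Isw : integral (s w) by apply: integral_morph.
(* Since [w - s w = t], the first dual relation gives [t ^+ 2 = p]. *)
exists p, w, (- (s w * t)), t; split.
- by rewrite expnS expn1 dvdn_mulr.
- by split=> //; rewrite -mulN1r; apply: integral_mul;
  [apply: integral_opp (integral1 _) | apply: integral_mul].
- by move=> s' s't; rewrite /w rmorphM fmorphV rmorph_nat rmorphD rmorph1 s't.
- by rewrite sw -t2 /w; field.
- by rewrite addrC subrr.
Qed.

(** The numerator times the denominator differs from [q] by the square of the denominator, so the
    square-free part of its absolute value serves as [n]. *)
Lemma rat_square_class (q : rat) : q != 0 -> exists (b : bool) (n : nat) (t :
  rat),
  [/\ (0 < n)%N, forall d, (d ^ 2 %| n)%N -> d = 1%N, t != 0
    & q = (-1) ^+ b * n%:R * t ^+ 2].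
Proof.
move=> q0; pose N := (`|numq q| * `|denq q|)%N.
have N0 : (0 < N)%N by rewrite muln_gt0 !absz_gt0 numq_eq0 q0 denq_neq0.
have [n [k [NE k0 sfn]]] := square_free_part N0.
exists (q < 0), n, (k%:R / (denq q)%:~R); split => //.
- by move: N0; rewrite NE; case: (n).
- by rewrite mulf_neq0 ?invr_eq0 ?intr_eq0 ?denq_neq0 // pnatr_eq0 -lt0n.
rewrite exprMn mulrA -[_ * k%:R ^+ 2]mulrA -natrX -natrM -NE natrM exprVn.
have d0 : (denq q)%:~R != 0 :> rat by rewrite intr_eq0 denq_neq0.
have dE : `|denq q|%N%:R = (denq q)%:~R :> rat.
  by rewrite -[LHS]/(`|denq q|%N%:Z%:~R) absz_denq.
have nE : (-1) ^+ (q < 0)%R * `|numq q|%N%:R = (numq q)%:~R :> rat.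
  rewrite -[_%:R]/(`|numq q|%N%:Z%:~R) [in RHS](intEsign (numq q)) rmorphM.
  by rewrite rmorph_sign numq_lt0.
by rewrite mulrA nE dE -[LHS]divq_num_den; field.
Qed.

Lemma integral_sign (b : bool) (x : K) : integral x -> integral ((-1) ^+ b * x).
Proof.
by case: b; rewrite ?mul1r // mulN1r => ?; apply: integral_opp.
Qed.

Lemma unit_product_square (e1 e2 e3 : K) :
  (p1 <> 3 %[mod 4])%N -> (p2 <> 3 %[mod 4])%N ->
  integral e1 -> integral e1^-1 -> integral e2 -> integral e2^-1 ->
  integral e3 -> integral e3^-1 ->
  e1 != 0 -> e2 != 0 -> e3 != 0 -> e1 ^+ 2 != -1 ->
  s1 e1 = - e1^-1 -> s2 e1 = e1 -> s1 e2 = e2 -> s2 e2 = - e2^-1 ->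
  s1 e3 = - e3^-1 -> s2 e3 = - e3^-1 ->
  exists (b : bool) (d : K), d ^+ 2 = (-1) ^+ b * (e1 * e2 * e3).
Proof.
move=> p1m p2m I1 I1V I2 I2V I3 I3V e1n0 e2n0 e3n0 e1sq c11 c21 c12 c22 c13 c23.
have [rho [dl [f1 f2 rho0 eE]]] :=
  square_class_fixed e1n0 e2n0 e3n0 e1sq c11 c21 c12 c22 c13 c23.
have [q qE] := conj_fixed_rat f1 f2.
have q0 : q != 0 by apply: contraNneq rho0 => q0; rewrite qE q0 scale0r.
have [b [n [t [n0 sfn t0 qnt]]]] := rat_square_class q0.
pose u := (-1) ^+ b * (e1 * e2 * e3).
have u0 : u != 0 by rewrite mulf_neq0 ?signr_eq0 // !mulf_neq0.
have Iu : integral u by apply/integral_sign/integral_mul => //;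
  apply: integral_mul.
have IuV : integral u^-1.
  rewrite invfM invr_sign; apply/integral_sign; rewrite !invfM.
  by apply/integral_mul => //; apply: integral_mul.
pose theta := n%:R * in_alg K t * dl.
have uE : u = n%:R * (in_alg K t * dl) ^+ 2.
  rewrite /u eE qE -/(in_alg K q) qnt !rmorphM rmorph_sign rmorph_nat.
  by rewrite !mulrA -signr_addb addbb expr0; ring.
have theta2 : theta ^+ 2 = n%:R * u by rewrite /theta uE; ring.
have [D1 [w1 [a1 [b1 [D1p [Iw1 Ia1 Ib1] fix1 E1 E1']]]]] :=
  quadratic_dual_basis pr_p1 p1m r1E s1r1.
have [D2 [w2 [a2 [b2 [D2p [Iw2 Ia2 Ib2] fix2 E2 E2']]]]] :=
  quadratic_dual_basis pr_p2 p2m r2E s2r2.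
have nD := square_free_dvd_discriminant conj1K conj2K conj12C conj_fixed_rat n0
  sfn u0 Iu IuV
  theta2 Iw1 Iw2 Ia1 Ia2 Ib1 Ib2 (fix1 _ s2r1) (fix2 _ s1r2) E1 E1' E2 E2'.
have np : (n %| p1 * p2)%N.
  (* Two reductions are needed: [D1 * D2] is only known to divide [(p1 * p2) ^ 2], so [nD] bounds
     [n] by a fourth power. *)
  apply: square_free_dvd => //; apply: square_free_dvd => //.
  apply: dvdn_trans nD _; apply: dvdn_exp2r; rewrite expnMn.
  exact: dvdn_mul.
(* The divisors 1, [p1], [p2] and [p1 * p2] have the square roots 1, [r1], [r2] and [r1 * r2] in
   [K]. *)
have [r rE] : exists r : K, r ^+ 2 = n%:R.
  have dvd_prime p m : prime p -> (m %| p)%N -> m = 1%N \/ m = p.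
    by move=> pr_p /(primeP pr_p).2 /pred2P.
  have [/dvdnP[m nE]|p1n] := boolP (p1 %| n)%N.
    move: np; rewrite nE mulnC dvdn_pmul2l ?prime_gt0 // =>
      /(dvd_prime _ _ pr_p2)[]mE.
      by exists r1; rewrite mE muln1.
    by exists (r1 * r2); rewrite exprMn r1E r2E mE natrM.
  move: np; rewrite Gauss_dvdr ?[coprime n p1]coprime_sym ?prime_coprime //.
  by move=> /(dvd_prime _ _ pr_p2)[]->; [exists 1; rewrite expr1n | exists r2].
exists b, (r * (in_alg K t * dl)); rewrite exprMn rE -uE //.
Qed.

Lemma conj_exprz (x : K) (n : int) :
  (- x^-1) ^ n = (-1) ^+ odd `|n|%N * (x ^ n)^-1.
Proof.
rewrite -[- x^-1]mulN1r expfzMl exprz_inv -invr_expz signr_odd; congr (_ * _).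
by case: n => // n; rewrite NegzE -exprnN -exprVn invrN1 abszN.
Qed.

(** In [2 * x = x + s1 x] the coordinates that involve [r1] cancel. *)
Lemma conj1_fixed x : s1 x = x -> x \in <<1; r2>>%VS.
Proof.
move=> s1x; have [a [b [c [d xE]]]] := biquadratic_coord x.
have -> : x = a%:A + c%:A * r2.
  apply: (mulfI (natr_fieldExt_neq0 K 1)).
  transitivity (x + s1 x); first by rewrite s1x; ring.
  by rewrite xE !coordE s1r1 s1r2; ring.
exact: mem_adjoin1_affine.
Qed.

Lemma conj2_fixed x : s2 x = x -> x \in <<1; r1>>%VS.
Proof.
move=> s2x; have [a [b [c [d xE]]]] := biquadratic_coord x.
have -> : x = a%:A + b%:A * r1.
  apply: (mulfI (natr_fieldExt_neq0 K 1)).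
  transitivity (x + s2 x); first by rewrite s2x; ring.
  by rewrite xE !coordE s2r1 s2r2; ring.
exact: mem_adjoin1_affine.
Qed.

Lemma conj12_fixed x : s1 (s2 x) = x -> x \in <<1; (r1 * r2)>>%VS.
Proof.
move=> s12x; have [a [b [c [d xE]]]] := biquadratic_coord x.
have -> : x = a%:A + d%:A * (r1 * r2).
  apply: (mulfI (natr_fieldExt_neq0 K 1)).
  transitivity (x + s1 (s2 x)); first by rewrite s12x; ring.
  rewrite xE !coordE !(s1r1, s1r2, s2r1, s2r2) !rmorphN !(s1r1, s1r2).
  by ring.
exact: mem_adjoin1_affine.
Qed.

(** [s1] fixes the rationals and negates [r1 * r2], which is not zero. *)
Lemma sqrt_product_irrational : r1 * r2 \notin 1%VS.
Proof.
apply/negP => /vlineP[q qE]; have := congr1 s1 qE.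
rewrite rmorph_rat_alg -qE rmorphM s1r1 s1r2 mulNr => /eqP.
rewrite eq_sym -subr_eq0 opprK -mulr2n -mulr_natl !mulf_eq0.
rewrite (negPf (natr_fieldExt_neq0 K 1)) -!(sqrf_eq0 r1) -(sqrf_eq0 r2) r1E r2E.
case: p1 pr_p1 => // m _; case: p2 pr_p2 => // l _.
by rewrite !(negPf (natr_fieldExt_neq0 K _)).
Qed.

Lemma adjoin1_conj (t x : K) (s : {rmorphism K -> K}) :
  t ^+ 2 \in 1%VS -> s t = t -> x \in <<1; t>>%VS -> s x = x.
Proof.
move=> t2 st xE.
have [a [b [/vlineP[a' ->] /vlineP[b' ->] ->]]] := Fadjoin_sqrtP t2 xE.
by rewrite !coordE st.
Qed.

(** Norm -1 is used only in this form: the conjugation inverts [x] up to the sign -1. *)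
Lemma norm_conj (t x : K) (s : {rmorphism K -> K}) :
  t ^+ 2 \in 1%VS -> t \notin 1%VS -> s t = - t -> x \in <<1; t>>%VS ->
  galNorm 1 <<1; t>> x = -1 -> x != 0 /\ s x = - x^-1.
Proof.
move=> t2 t1 st xE; rewrite (galNorm_quadratic t2 t1 st xE) => Nx.
have x0 : x != 0.
  by apply: contra_eq_neq Nx => ->; rewrite mul0r eq_sym oppr_eq0 oner_eq0.
by split=> //; apply: (mulfI x0); rewrite Nx mulrN divff.
Qed.

(** * The log-unit lattice of the biquadratic field *)

Section Embeddings.
Variables (R : realType) (phi : real_embeddings R K).

(* An embedding is determined by the signs of the images of r1 and r2, and all
   four pairs of signs occur since there are four embeddings. *)
Lemma embedding_conj (s : {rmorphism K -> K}) i :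
  exists j, phi j =1 phi i \o s.
Proof.
pose sgn (f : {rmorphism K -> R}) := (0 < f r1, 0 < f r2).
have sgn_inj (f g : {rmorphism K -> R}) : sgn f = sgn g -> f =1 g.
  have same t n : t ^+ 2 = n%:R -> (0 < f t) = (0 < g t) -> f t = g t.
    move=> t2 pos; have := erefl (g t ^+ 2).
    rewrite -{1}rmorphXn t2 rmorph_nat -(rmorph_nat f) -t2 rmorphXn => /eqP.
    rewrite eqf_sqr => /orP[/eqP //|/eqP fg]; move: pos; rewrite fg oppr_gt0.
    by case: (ltgtP (g t) 0) => // ->; rewrite oppr0.
  by case=> e1 e2; apply: rmorph_biquadratic_eq;
    [apply: same r1E _ | apply: same r2E _].
have sgn_phi_inj : injective (fun j => sgn (phi j)).
  by move=> j k /sgn_inj; apply: embedding_inj.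
have /codomP[j jE] : sgn (phi i \o s) \in codom (fun j => sgn (phi j)).
  apply: inj_card_onto => //.
  by rewrite card_ord biquadratic_dim card_prod card_bool.
by exists j; apply: sgn_inj.
Qed.

Variables e1 e2 e3 : K.
Hypotheses (e1_neq0 : e1 != 0) (e2_neq0 : e2 != 0) (e3_neq0 : e3 != 0).
Hypotheses (s1e1 : s1 e1 = - e1^-1) (s2e1 : s2 e1 = e1).
Hypotheses (s1e2 : s1 e2 = e2) (s2e2 : s2 e2 = - e2^-1).
Hypotheses (s1e3 : s1 e3 = - e3^-1) (s2e3 : s2 e3 = - e3^-1).

(** [s] acts as an isometry that negates [Log x] and fixes [Log y], so the product equals its own
    negative. *)
Lemma dotp_Log_opp (s : {rmorphism K -> K}) x y : involutive s ->
  x != 0 -> s x = - x^-1 -> s y = y ->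
  dotp (Log phi x) (Log phi y) = 0.
Proof.
move=> sK x0 sx sy; have := dotp_Log_conj x y sK (embedding_conj s).
rewrite sx sy LogN LogV // -scaleN1r dotpZl mulN1r; move: (dotp _ _) => z; lra.
Qed.

(* eta^2 = N1 N2 / s1 N3, where N_i is the relative norm of eta to K_i. *)
Lemma unit_sqr_decomposition (E1 : forall x, s2 x = x -> integer_units x ->
      exists (b : bool) (n : int), x = (-1) ^+ b * e1 ^ n)
    (E2 : forall x, s1 x = x -> integer_units x ->
      exists (b : bool) (n : int), x = (-1) ^+ b * e2 ^ n)
    (E3 : forall x, s1 (s2 x) = x -> integer_units x ->
      exists (b : bool) (n : int), x = (-1) ^+ b * e3 ^ n) eta :
  integer_units eta -> exists (d : bool) (a b c : int),
    eta ^+ 2 = (-1) ^+ d * (e1 ^ a * e2 ^ b * e3 ^ c).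
Proof.
move=> /integer_unitsP[eta0 Ieta IetaV].
have unitN (s : {rmorphism K -> K}) : integer_units (eta * s eta).
  apply/integer_unitsP; split; first by rewrite mulf_neq0 ?fmorph_eq0.
    by apply: integral_mul => //; apply: integral_morph.
  by rewrite invfM -fmorphV; apply: integral_mul => //; apply: integral_morph.
have [d1 [a aE]] : exists (b : bool) (n : int),
  eta * s2 eta = (-1) ^+ b * e1 ^ n.
  by apply: E1; [rewrite rmorphM conj2K mulrC | apply: unitN].
have [d2 [b bE]] : exists (b : bool) (n : int),
  eta * s1 eta = (-1) ^+ b * e2 ^ n.
  by apply: E2; [rewrite rmorphM conj1K mulrC | apply: unitN].
have [d3 [c cE]] : exists (b : bool) (n : int),
    eta * s1 (s2 eta) = (-1) ^+ b * e3 ^ n.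
  apply: E3; last exact: (unitN (s1 \o s2)).
  by rewrite !rmorphM -(conj12C (s2 eta)) conj2K conj1K mulrC.
(* This sign comes from [s1 e3 = - e3^-1] raised to the power [c]. *)
set d4 := odd `|c|%N.
exists (d1 (+) d2 (+) d3 (+) d4), a, b, c.
have s1c : s1 eta * s2 eta = (-1) ^+ d3 * ((-1) ^+ d4 * (e3 ^ c)^-1).
  have <- : s1 (eta * s1 (s2 eta)) = s1 eta * s2 eta by rewrite rmorphM conj1K.
  by rewrite cE rmorphM rmorph_sign fmorphXz s1e3 conj_exprz.
have s1s2_neq0 : s1 eta * s2 eta != 0 by rewrite mulf_neq0 ?fmorph_eq0.
apply: (mulIf s1s2_neq0).
transitivity ((eta * s2 eta) * (eta * s1 eta)); first by ring.
rewrite aE bE s1c !signr_addb.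
by case: d3 {s1c cE} => /=; case: d4 => /=; field; rewrite ?expr0 expfz_neq0.
Qed.

(** The square of [eta * s eta / y ^ b] is [(-1) ^ (a + c)], and -1 is not a square in a field with
    a real embedding. *)
Lemma exponent_parity (s : {rmorphism K -> K}) (d : bool) (x y z eta : K)
    (a b c : int) : x != 0 -> y != 0 -> z != 0 ->
  s x = - x^-1 -> s y = y -> s z = - z^-1 ->
  eta ^+ 2 = (-1) ^+ d * (x ^ a * y ^ b * z ^ c) -> (2 %| a + c)%Z.
Proof.
move=> x0 y0 z0 sx sy sz eta2; rewrite dvdzE dvdn2.
have -> : odd `|(a + c)%R|%N = odd `|a|%N (+) odd `|c|%N by lia.
apply: contra (sqr_neqN1 phi (eta * s eta / y ^ b)) => odd_ac.
have := congr1 s eta2; rewrite rmorphXn !rmorphM rmorph_sign !fmorphXz sx sy sz.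
rewrite !conj_exprz => seta2.
have := expfz_neq0 a x0; have := expfz_neq0 b y0; have := expfz_neq0 c z0.
rewrite !exprMn seta2 eta2 exprVn; move: (x ^ a) (y ^ b) (z ^ c) odd_ac =>
  X Y Z.
case: (odd `|a|%N) (odd `|c|%N) => -[] //= _ Z0 Y0 X0; apply/eqP;
  by case: d {eta2 seta2} => /=; field; rewrite ?X0 ?Y0 ?Z0.
Qed.

(** The box axes are the halves of [Log e1], [Log e2], [Log e3]. The square root [d] of
    [e1 * e2 * e3] up to sign supplies the half-diagonals, and the exponents of [eta ^+ 2] are the
    coordinates of [Log eta]. *)
Lemma log_unit_lattice_not_orthogonal :
  (p1 <> 3 %[mod 4])%N -> (p2 <> 3 %[mod 4])%N ->
  integer_units e1 -> integer_units e2 -> integer_units e3 ->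
  (forall x, s2 x = x -> integer_units x ->
      exists (b : bool) (n : int), x = (-1) ^+ b * e1 ^ n) ->
  (forall x, s1 x = x -> integer_units x ->
      exists (b : bool) (n : int), x = (-1) ^+ b * e2 ^ n) ->
  (forall x, s1 (s2 x) = x -> integer_units x ->
      exists (b : bool) (n : int), x = (-1) ^+ b * e3 ^ n) ->
  ~ orthogonal_lattice (log_unit_lattice phi).
Proof.
move=> p1m p2m /integer_unitsP[_ I1 I1V] /integer_unitsP[_ I2 I2V].
move=> /integer_unitsP[_ I3 I3V] E1 E2 E3.
have two0 : 2 != 0 :> R by rewrite pnatr_eq0.
have half0 : 2^-1 != 0 :> R by rewrite invr_eq0.
have halfK (v : 'rV[R]_(\dim {:K})) : 2^-1 *: v + 2^-1 *: v = v.
  by rewrite -scalerDl (_ : 2^-1 + 2^-1 = 1) ?scale1r //; field.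
(* If [x ^+ 2 = 1], then [x] is 1 or -1, hence fixed by [s], and [x = - x^-1] would make -1 a
   square. *)
have Log_e x (s : {rmorphism K -> K}) : x != 0 -> s x = - x^-1 ->
    2^-1 *: Log phi x != 0.
  move=> x0 sx; rewrite scaler_eq0 negb_or half0 Log_neq0 //.
  apply/eqP => /eqP; rewrite sqrf_eq1 => x1.
  have sxx : s x = x by case/orP: x1 => /eqP ->; rewrite ?rmorphN rmorph1.
  case/negP: (sqr_neqN1 phi x); rewrite expr2 -{1}sxx sx.
  by rewrite mulNr mulVf.
have [b [d d2]] := unit_product_square p1m p2m I1 I1V I2 I2V I3 I3V
  e1_neq0 e2_neq0 e3_neq0 (sqr_neqN1 phi e1) s1e1 s2e1 s1e2 s2e2 s1e3 s2e3.
have ud : integer_units d.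
  have d0 : d != 0 by rewrite -sqrf_eq0 d2 mulf_neq0 ?signr_eq0 // !mulf_neq0.
  apply/integer_unitsP; split=> //; apply: integral_sqr.
    rewrite d2; apply: integral_sign.
    by apply: integral_mul => //; apply: integral_mul.
  rewrite exprVn d2 invfM invr_sign; apply: integral_sign.
  by rewrite !invfM; apply: integral_mul => //; apply: integral_mul.
have uM x y : integer_units x -> integer_units y -> integer_units (x * y).
  move=> /integer_unitsP[x0 Ix IxV] /integer_unitsP[y0 Iy IyV].
  apply/integer_unitsP; split; [exact: mulf_neq0 | exact: integral_mul |].
  by rewrite invfM; apply: integral_mul.
have uV x : x != 0 -> integral x -> integral x^-1 -> integer_units x^-1.
  by move=> x0 Ix IxV; apply/integer_unitsP; rewrite invr_eq0 invrK.
have d0 : d != 0 by case/integer_unitsP: ud.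
have Logd : Log phi d = 2^-1 *: Log phi e1 + 2^-1 *: Log phi e2 + 2^-1 *: Log
  phi e3.
  apply: (scalerI two0); rewrite -!scalerDr scalerA divff // scale1r.
  rewrite scaler_nat mulr2n -LogM // -expr2 d2 Log_sign !LogM //.
  by rewrite mulf_neq0.
apply: (@body_centred_not_orthogonal _ _ _
  (2^-1 *: Log phi e1) (2^-1 *: Log phi e2) (2^-1 *: Log phi e3)).
- exact: Log_e s1e1.
- exact: Log_e s2e2.
- exact: Log_e s1e3.
- by rewrite dotpZl dotpZr (dotp_Log_opp conj1K e1_neq0 s1e1 s1e2) !mulr0.
- by rewrite dotpZl dotpZr dotpC (dotp_Log_opp conj2K e3_neq0 s2e3 s2e1) !mulr0.
- by rewrite dotpZl dotpZr dotpC (dotp_Log_opp conj1K e3_neq0 s1e3 s1e2) !mulr0.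
- by exists d.
(* Dividing [d] by [e1] subtracts twice the first axis vector, which flips its sign. *)
- exists (d * e1^-1); first by apply: uM => //; apply: uV.
  rewrite LogM ?invr_eq0 // LogV // Logd -[X in _ - X]halfK.
  by apply/rowP => j; rewrite !mxE; ring.
- exists (d * e2^-1); first by apply: uM => //; apply: uV.
  rewrite LogM ?invr_eq0 // LogV // Logd -[X in _ - X]halfK.
  by apply/rowP => j; rewrite !mxE; ring.
move=> _ [eta ueta <-].
have [sg [a [b' [c etaE]]]] := unit_sqr_decomposition E1 E2 E3 ueta.
have eta0 : eta != 0 by case/integer_unitsP: ueta.
exists a, b', c; split.
- apply: (scalerI two0); rewrite scaler_nat mulr2n -LogM // -expr2 etaE
  Log_sign.
  rewrite !LogM ?mulf_neq0 ?expfz_neq0 // !LogXz //.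
  rewrite !scalerDr !scalerA.
  by congr (_ *: _ + _ *: _ + _ *: _); field.
- exact: exponent_parity e1_neq0 e2_neq0 e3_neq0 s1e1 s1e2 s1e3 etaE.
(* The second congruence is the first with [s2] for [s1] and the roles of [e1] and [e2]
   exchanged. *)
move: etaE; rewrite [e1 ^ a * _]mulrC.
exact: exponent_parity e2_neq0 e1_neq0 e3_neq0 s2e2 s2e1 s2e3.
Qed.

End Embeddings.
End Biquadratic.

(** * Passage from the quadratic subfields to [K] *)

Lemma integer_units_vsval (K : fieldExtType rat) (E : {subfield K})
    (x : subvs_of E) : integer_units x -> integer_units (vsval x).
Proof.
move=> /integer_unitsP[x0 Ix IxV]; apply/integer_unitsP; split.
- by rewrite fmorph_eq0.
- exact: (integral_morph vsval).
by rewrite -fmorphV; apply: (integral_morph vsval).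
Qed.

Theorem theorem1p3 (R : realType) (p1 p2 : nat)
    (K : splittingFieldType rat) (r1 r2 : K)
    (phi : real_embeddings R K)
    (phi1 : real_embeddings R (subvs_of <<1; r1>>%AS))
    (phi2 : real_embeddings R (subvs_of <<1; r2>>%AS))
    (phi3 : real_embeddings R (subvs_of <<1; (r1 * r2)>>%AS))
    (eps1 : subvs_of <<1; r1>>%AS)
    (eps2 : subvs_of <<1; r2>>%AS)
    (eps3 : subvs_of <<1; (r1 * r2)>>%AS) :
  prime p1 -> prime p2 -> p1 <> p2 ->
  r1 ^+ 2 = p1%:R -> r2 ^+ 2 = p2%:R -> <<<<1; r1>>; r2>>%VS = {:K}%VS ->
  fundamental_unit phi1 eps1 ->
  fundamental_unit phi2 eps2 ->
  fundamental_unit phi3 eps3 ->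
  (p1 = 1 %[mod 4])%N -> (p2 <> 3 %[mod 4])%N ->
  galNorm 1 <<1; r1>> (vsval eps1) = -1 ->
  galNorm 1 <<1; r2>> (vsval eps2) = -1 ->
  galNorm 1 <<1; (r1 * r2)>> (vsval eps3) = -1 ->
  ~ orthogonal_lattice (log_unit_lattice phi).

Proof.
move=> pr_p1 pr_p2 p12 r1E r2E genK fund1 fund2 fund3 p1m p2m N1 N2 N3.
have p1m3 : (p1 <> 3 %[mod 4])%N by rewrite p1m.
have [s1 [s2 [s1r1 s1r2 s2r1 s2r2]]] := biquadratic_conj pr_p1 pr_p2 p12 r1E
  r2E.
have sq1 : r1 ^+ 2 \in 1%VS by rewrite r1E rpred_nat.
have sq2 : r2 ^+ 2 \in 1%VS by rewrite r2E rpred_nat.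
have sq3 : (r1 * r2) ^+ 2 \in 1%VS by rewrite exprMn r1E r2E -natrM rpred_nat.
have s1r12 : s1 (r1 * r2) = - (r1 * r2) by rewrite rmorphM s1r1 s1r2 mulNr.
have s2r12 : s2 (r1 * r2) = - (r1 * r2) by rewrite rmorphM s2r1 s2r2 mulrN.
have irr3 := sqrt_product_irrational pr_p1 pr_p2 r1E r2E s1r1 s1r2.
have [e1_neq0 s1e1] := norm_conj sq1 (sqrt_prime_irrational pr_p1 r1E) s1r1
  (subvsP eps1) N1.
have [e2_neq0 s2e2] := norm_conj sq2 (sqrt_prime_irrational pr_p2 r2E) s2r2
  (subvsP eps2) N2.
(* Both [s1] and [s2] negate [r1 * r2], so each restricts to the conjugation of the third
   subfield. *)
have [e3_neq0 s1e3] := norm_conj sq3 irr3 s1r12 (subvsP eps3) N3.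
have [_ s2e3] := norm_conj sq3 irr3 s2r12 (subvsP eps3) N3.
have s2e1 := adjoin1_conj sq1 s2r1 (subvsP eps1).
have s1e2 := adjoin1_conj sq2 s1r2 (subvsP eps2).
apply: (log_unit_lattice_not_orthogonal pr_p1 pr_p2 p12 r1E r2E genK
  s1r1 s1r2 s2r1 s2r2 e1_neq0 e2_neq0 e3_neq0 s1e1 s2e1 s1e2 s2e2 s1e3 s2e3) =>
    //.
- by case: fund1 => /integer_units_vsval.
- by case: fund2 => /integer_units_vsval.
- by case: fund3 => /integer_units_vsval.
(* The elements fixed by [s2] lie in the field of [r1], so the units among them are powers of [eps1]
   up to sign; the other two subfields are treated alike. *)
- move=> x s2x; apply: fundamental_unit_generates fund1 _.
  exact: (conj2_fixed r1E r2E genK s2r1 s2r2).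
- move=> x s1x; apply: fundamental_unit_generates fund2 _.
  exact: (conj1_fixed r1E r2E genK s1r1 s1r2).
move=> x s12x; apply: fundamental_unit_generates fund3 _.
exact: (conj12_fixed r1E r2E genK s1r1 s1r2 s2r1 s2r2).
Qed.
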